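(* Let $\gamma<1$ and assume that the right end point of the support of $\mu$ is $b=\frac{1}{1-\gamma}$. Let $a$ be the left end point of the support of $\mu$. Then, for each $x_0>0$, $$\lim_{t\uparrow\infty}\frac{r(x_0,t)}{x_0}=a.$$ Furthermore, with $\Delta(x_0,t):=\frac{h^{(-1)}(x_0,t)}{t}-\frac a2$, define $$G(x_0,t):=\begin{cases}\displaystyle\int_{[a,\frac{1}{1-\gamma}]}(y-a)\,e^{-ty\frac{y-a}{2}}\,\mu(dy), & \Delta(x_0,t)<0,\\[2ex] \displaystyle 2\Delta(x_0,t)\,x_0+\int_{[a+2\Delta(x_0,t),\frac{1}{1-\gamma}]}(y-a)\,e^{ty\frac{2\Delta(x_0,t)+a-y}{2}}\,\mu(dy), & \Delta(x_0,t)>0.\end{cases}$$ Then $\lim_{t\uparrow\infty}G(x_0,t)=0$, and for $t$ large enough, $$0\le r(x_0,t)-a x_0\le G(x_0,t).$$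
   Context: Let $\mu$ be a nonzero finite positive Borel measure on $(0,\infty)$ such that $\int y e^{yz}\mu(dy)<\infty$ for every $z\in\mathbb{R}$. Let $a:=\inf\{y\ge 0:\mu((0,y])>0\}$ and $b:=\inf\{y>0:\mu((y,\infty))=0\}$ denote the end points of its support. Define $h(z,t):=\int e^{yz-\frac12 y^2 t}\mu(dy)$ for $(z,t)\in\mathbb{R}\times[0,\infty)$. For each $t$, the map $z\mapsto h(z,t)$ is smooth and strictly increasing with range $(0,\infty)$, and $h_t+\frac12 h_{zz}=0$. $h^{(-1)}(x,t)$ denotes its inverse in $z$. Let $u:(0,\infty)\times[0,\infty)\to\mathbb{R}$ be smooth, strictly increasing and strictly concave in $x$, solving $u_t=\frac12 u_x^2/u_{xx}$, and related to $h$ by $u_x(h(z,t),t)=e^{-z+t/2}$ for all $(z,t)$. The risk tolerance function is $r(x,t):=-u_x(x,t)/u_{xx}(x,t)$. Equivalently, $$r(x,t)=h_z(h^{(-1)}(x,t),t)=\int y\,e^{y h^{(-1)}(x,t)-\frac12 y^2 t}\mu(dy).$$ *)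

(* Defs.v *)
From HB Require Import structures.
From mathcomp Require Import all_boot all_order all_algebra.
From mathcomp Require Import all_classical all_reals all_analysis.
Set Implicit Arguments. Unset Strict Implicit. Unset Printing Implicit Defensive.
Import Order.TTheory GRing.Theory Num.Theory.
Import numFieldNormedType.Exports.
Local Open Scope classical_set_scope.
Local Open Scope ring_scope.

Section Defs.
Variable R : realType.
Variable mu : {measure set R -> \bar R}.

Definition hfun (z t : R) : R :=
  \int[mu]_(y in setT) expR (y * z - y ^+ 2 * t / 2).

Definition hinv (x t : R) : R := xget 0 [set z | hfun z t = x].

(* r(x,t) = h_z(h^{(-1)}(x,t),t) = int y e^{y h^{-1}(x,t) - y^2 t/2} mu(dy) *)
Definition rtol (x t : R) : R :=
  \int[mu]_(y in setT) (y * expR (y * hinv x t - y ^+ 2 * t / 2)).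

Definition supp_left : R :=
  inf [set y : R | 0 <= y /\ (0 < mu [set w : R | (0 < w <= y)%R])%E].

Definition supp_right : R :=
  inf [set y : R | 0 < y /\ mu [set w | y < w] = 0%E].

Definition Delta (x0 t : R) : R := hinv x0 t / t - supp_left / 2.

Definition Gfun (gamma x0 t : R) : R :=
  let a := supp_left in
  let D := Delta x0 t in
  if D <= 0 then
    \int[mu]_(y in [set w | a <= w <= (1 - gamma)^-1])
       ((y - a) * expR (- (t * y * (y - a) / 2)))
  else
    2 * D * x0 +
    \int[mu]_(y in [set w | a + 2 * D <= w <= (1 - gamma)^-1])
       ((y - a) * expR (t * y * (2 * D + a - y) / 2)).

End Defs.

(* Main.v *)
Require Import Defs.
From HB Require Import structures.
From mathcomp Require Import all_boot all_order all_algebra.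
From mathcomp Require Import all_classical all_reals all_analysis.
From mathcomp Require Import measurable_realfun ring lra.
Import Order.TTheory GRing.Theory Num.Theory.
Import numFieldNormedType.Exports.
Local Open Scope classical_set_scope.
Local Open Scope ring_scope.

(** With D = Delta(x0, t), the exponent of the integrand of h at the point
    h^{-1}(x0, t) is t y (a + 2 D - y) / 2 =: log E(y), so that x0 is the
    integral of E and r - a x0 the integral of (y - a) E(y).  This gives
    0 <= r - a x0 <= G by bounding y - a by 2 D where y < a + 2 D.
    The integrands of G are at most (2 t)^{-1/2} + 2 max(0, D), whence G -> 0
    once limsup D <= 0; the latter holds because E would otherwise grow
    exponentially on a set of positive mass just above a, while its integral
    is x0. *)

(** Clearing denominators leaves [q * s <= expR (q ^+ 2 * s ^+ 2 / 4)], which follows from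
    [1 + u <= expR u] and the square of [q * s / 2 - 1]. The choice [q = Num.sqrt (2 * t)] yields
    the decay rate of the integrands of [G]. *)
Lemma mul_expRN_sqr_le (R : realType) (q s : R) : 0 < q ->
  s * expR (- (q ^+ 2 * s ^+ 2 / 4)) <= q^-1.
Proof.
move=> q0; rewrite expRN -[leRHS]mul1r ler_pdivlMr// mulrAC ler_pdivrMr ?expR_gt0//.
rewrite mul1r; apply: le_trans (expR_ge1Dx _).
have := sqr_ge0 (q * s / 2 - 1); nra.
Qed.

(** * Integrals of bounded functions and small sets for a finite measure *)

Section integral_bounds.
Context {R : realType} (mu : {finite_measure set R -> \bar R}).
Implicit Types (A D : set R) (f : R -> R).

Lemma bounded_integrable A f (C : R) : measurable A ->
  measurable_fun [set: R] f -> (forall x, A x -> `|f x| <= C) ->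
  mu.-integrable A (EFin \o f).
Proof.
move=> mA mf fC; apply: measurable_bounded_integrable => //.
- by rewrite ltey_eq fin_num_measure.
- exact: measurable_funTS.
- exists C; split; first exact: num_real.
  by move=> x Cx y Ay /=; apply: le_trans (fC _ Ay) (ltW Cx).
Qed.

(** [f] and its restriction to [D] differ only on a null set, so the extended-real integrals agree
    before [fine] is applied. *)
Lemma Rintegral_conull D f : measurable D -> mu (~` D) = 0%E ->
  measurable_fun [set: R] f ->
  \int[mu]_(x in [set: R]) f x = \int[mu]_(x in D) f x.
Proof.
move=> mD D0 mf; rewrite [RHS]Rintegral_mkcond; congr fine.
apply: ae_eq_integral => //.
- exact/measurable_EFinP.
- by apply/measurable_EFinP/(measurable_restrictT _ mD); exact: measurable_funTS.
- exists (~` D); split => //; first exact: measurableC.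
  move=> x; apply: contra_not => Dx _.
  by rewrite patchE mem_set.
Qed.

Lemma Rintegral_le_cst A f (C : R) : measurable A ->
  measurable_fun [set: R] f -> (forall x, A x -> 0 <= f x <= C) ->
  \int[mu]_(x in A) f x <= C * fine (mu A).
Proof.
move=> mA mf fC; rewrite -Rintegral_cst//; apply: le_Rintegral => //.
- apply: (@bounded_integrable _ _ C) => // x /fC /andP[f0 fC'].
  by rewrite ger0_norm.
- by apply: (@bounded_integrable _ (fun=> C) `|C|).
- by move=> x /fC /andP[].
Qed.

(** [B] makes [f] integrable on [D], and nonnegativity allows the passage from [A] to the larger
    [D]. *)
Lemma Rintegral_ge_cst A D f (B C : R) : measurable A -> measurable D ->
  A `<=` D -> measurable_fun [set: R] f -> (forall x, D x -> 0 <= f x <= B) ->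
  (forall x, A x -> C <= f x) ->
  C * fine (mu A) <= \int[mu]_(x in D) f x.
Proof.
move=> mA mD AD mf f0 fC; rewrite -Rintegral_cst//.
have iD : mu.-integrable D (EFin \o f).
  apply: (@bounded_integrable _ _ B) => // x /f0 /andP[f0' fB].
  by rewrite ger0_norm.
apply: (@le_trans _ _ (\int[mu]_(x in A) f x)).
  apply: le_Rintegral => //.
  - by apply: (@bounded_integrable _ (fun=> C) `|C|).
  - exact: integrableS iD.
apply: fine_le.
- by apply: integrable_fin_num => //; exact: integrableS iD.
- exact: integrable_fin_num.
apply: ge0_subset_integral => //; last by move=> x /f0 /andP[]; rewrite lee_fin.
exact: (measurable_int mu).
Qed.

Lemma measure_bigcup0 (F : (set R)^nat) : (forall n, measurable (F n)) ->
  (forall n, mu (F n) = 0%E) -> mu (\bigcup_n F n) = 0%E.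
Proof.
move=> mF F0; apply: measure_negligible; first exact: bigcupT_measurable.
by apply: negligible_bigcup => n; exists (F n); split=> //; exact: F0.
Qed.

(** Were every [[l + 1/(n+1), y]] null, so would be their union []l, y]]. Keeping the mass away from
    [l = 0] gives the exponentials a uniform rate [d]. *)
Lemma measure_itvoc_gt0 (l y : R) : (0 < mu `]l, y]%classic)%E ->
  exists2 d, l < d & (0 < mu `[d, y]%classic)%E.
Proof.
move=> muy; apply: contrapT => /forall2NP muN.
suff mu0 : mu `]l, y]%classic = 0%E by rewrite mu0 ltxx in muy.
rewrite itv_open_bnd_bigcup; apply: measure_bigcup0 => // n.
have [|/negP] := muN (l + n.+1%:R^-1); first by rewrite ltrDl invr_gt0 ltr0n.
by rewrite -leNgt => mu0; apply/eqP; rewrite eq_le mu0 measure_ge0.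
Qed.

(** Continuity from above: the intervals []l, l + 1/(n+1)]] decrease to the empty set. *)
Lemma measure_itvoc_small (l e : R) : 0 < e ->
  exists2 d, l < d & (mu `]l, d]%classic < e%:E)%E.
Proof.
move=> e0; pose F n : set R := `]l, l + n.+1%:R^-1]%classic.
have capF : \bigcap_n F n = set0.
  rewrite -subset0 => x Fx.
  have lx : l < x by have := Fx 0%N I; rewrite /F/= in_itv/= => /andP[].
  have [k kx] := ltr_add_invr lx.
  have := Fx k I; rewrite /F/= in_itv/= => /andP[_].
  by rewrite leNgt kx.
have : mu \o F @ \oo --> 0%E.
  rewrite -(measure0 mu) -capF; apply: nonincreasing_cvg_mu => //.
  - by rewrite ltey_eq fin_num_measure//; exact: measurable_itv.
  - by move=> n; exact: measurable_itv.
  - by rewrite capF.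
  - move=> n m nm; apply/subsetPset => x; rewrite /F/= !in_itv/= => /andP[-> /=].
    by move/le_trans; apply; rewrite lerD2l lef_pV2 ?posrE ?ltr0n// ler_nat.
have /[swap]/[apply] : nbhs 0%E [set x : \bar R | (x < e%:E)%E].
  by apply: open_nbhs_nbhs; split; [exact: open_ereal_lt_ereal|rewrite /= lte_fin].
case=> N _ /(_ N (leqnn N))/= FN.
by exists (l + N.+1%:R^-1) => //; rewrite ltrDl invr_gt0 ltr0n.
Qed.

Lemma measurable_exp (z t : R) :
  measurable_fun [set: R] (fun y => expR (y * z - y ^+ 2 * t / 2)).
Proof.
apply: measurableT_comp => //; apply: measurable_funB.
  exact: measurable_funM.
by apply: measurable_funM => //; apply: measurable_funM => //;
  exact: measurable_funX.
Qed.

End integral_bounds.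

(** * The end points [a] and [b], and the null sets they determine *)

Section support.
Context {R : realType} (mu : {finite_measure set R -> \bar R}).
Hypothesis mu_le0 : mu [set y : R | y <= 0] = 0%E.
Hypothesis mu_gt0 : (0 < mu [set: R])%E.
Let a := supp_left mu.
Let b := supp_right mu.
Hypothesis b_gt0 : 0 < b.

Lemma supp_right_itvoy0 : mu `]b, +oo[%classic = 0%E.
Proof.
pose E := [set y : R | 0 < y /\ mu [set w | y < w] = 0%E].
(* [inf] of the empty set is 0, so [b > 0] forces some half-line []y, +oo[] to be null. *)
have E0 : E !=set0.
  apply/set0P/negP => /eqP E0; move: b_gt0.
  by rewrite /b /supp_right -/E E0 inf0 ltxx.
rewrite itvoyEbigcup; apply: measure_bigcup0 => [n|n]; first exact: measurable_itv.
have n0 : 0 < n.+1%:R^-1 :> R by rewrite invr_gt0 ltr0n.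
have [|y [y0 muy] yb] := @inf_adherent _ E _ n0.
  by split=> //; exists 0 => y [/ltW].
have -> : mu `[(b + n.+1%:R^-1), +oo[%classic = 0%E; last by [].
apply: (@subset_measure0 _ _ _ _ _ [set w | y < w]) muy.
- exact: measurable_itv.
- by rewrite -set_itvoy; exact: measurable_itv.
- by move=> w /=; rewrite in_itv/= andbT; apply: lt_le_trans.
Qed.

Lemma supp_right_null : mu (~` `]0, b]%classic) = 0%E.
Proof.
have -> : ~` `]0, b]%classic = [set y : R | y <= 0] `|` `]b, +oo[%classic.
  rewrite set_itvoc set_itvoy; apply/seteqP; split=> x /=.
    by move/negP; rewrite negb_and -!leNgt => /orP[]; [left|rewrite -ltNge; right].
  case=> [x0|bx]; apply/negP; rewrite negb_and -leNgt ?x0//.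
  by rewrite -ltNge bx orbT.
rewrite measureU0//; first by rewrite -set_itvNyc.
exact: supp_right_itvoy0.
Qed.

Let EA := [set y : R | 0 <= y /\ (0 < mu [set w : R | (0 < w <= y)%R])%E].

Let supp_left_has_inf : has_inf EA.
Proof.
split; last by exists 0 => y [].
(* [b] itself belongs to [EA], because []0, b]] carries all the mass. *)
exists b; split; first exact: ltW.
rewrite -set_itvoc; have := mu_gt0; rewrite -(setUv `]0, b]%classic) measureU0//.
- by apply: measurableC; exact: measurable_itv.
- exact: supp_right_null.
Qed.

Lemma supp_left_ge0 : 0 <= a.
Proof. by apply: lb_le_inf; [case: supp_left_has_inf|move=> y []]. Qed.

Lemma supp_left_itvoc_gt0 (y : R) : a < y -> (0 < mu `]0%R, y]%classic)%E.
Proof.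
case: supp_left_has_inf => + _ => /inf_lt/[apply] -[x [_]].
rewrite -set_itvoc => + xy => /lt_le_trans; apply.
apply: le_measure; rewrite ?inE; [exact: measurable_itv..|].
by move=> w /=; rewrite !in_itv/= => /andP[-> /le_trans]; apply; exact: ltW.
Qed.

Lemma supp_left_itvoo0 : mu `]0, a[%classic = 0%E.
Proof.
rewrite itv_bnd_open_bigcup; apply: measure_bigcup0 => n; first exact: measurable_itv.
apply/eqP/negPn/negP => mu0.
have := ge_inf supp_left_has_inf.2; have : EA (a - n.+1%:R^-1).
  (* A negative right end point makes the interval empty, hence null; otherwise it would be an
     element of [EA] below [a]. *)
  have [an|an] := leP 0 (a - n.+1%:R^-1); last first.
    by move: mu0; rewrite set_itv_ge ?measure0 ?eqxx// -leNgt bnd_simp ltW.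
  by split => //; rewrite -set_itvoc lt_neqAle eq_sym mu0 measure_ge0.
move=> /[swap]/[apply]; rewrite -/(supp_left mu) -/a lerBrDr gerDl leNgt.
by rewrite invr_gt0 ltr0n.
Qed.

Lemma supp_null : mu (~` `[a, b]%classic) = 0%E.
Proof.
have mu0 : mu (~` `]0, b]%classic `|` `]0, a[%classic) = 0%E.
  apply: etrans (measureU0 _ _ _) supp_right_null.
  - by apply: measurableC; exact: measurable_itv.
  - exact: measurable_itv.
  - exact: supp_left_itvoo0.
apply: (@subset_measure0 _ _ _ _ _ (~` `]0, b]%classic `|` `]0, a[%classic)).
- by apply: measurableC; exact: measurable_itv.
- by apply: measurableU; [apply: measurableC|]; exact: measurable_itv.
- move=> x /=; rewrite !in_itv/= => xab.
  have [x0|x0] := ltP 0 x; last by left.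
  have [xa|ax] := ltP x a; first by right.
  by left; apply: contra_not xab => /= xb; rewrite ax.
- exact: mu0.
Qed.

(** * Continuity and range of [h] in [z], and its inverse *)

Lemma hfun_supp (D : set R) (z t : R) : measurable D -> mu (~` D) = 0%E ->
  hfun mu z t = \int[mu]_(y in D) expR (y * z - y ^+ 2 * t / 2).
Proof.
by move=> mD D0; rewrite /hfun; apply: Rintegral_conull => //; exact: measurable_exp.
Qed.

(** Dominated convergence: for [|l| < N] the integrand on []0, b]] is at most the constant
    [expR (b * N)], integrable for a finite measure. *)
Lemma hfun_continuous (t : R) : 0 <= t -> continuous (hfun mu ^~ t).
Proof.
move=> t0 z.
have -> : hfun mu ^~ t =
    fun l => \int[mu]_(y in `]0, b]%classic) expR (y * l - y ^+ 2 * t / 2).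
  apply/funext => l; apply: hfun_supp; first exact: measurable_itv.
  exact: supp_right_null.
pose N := `|z| + 1.
have zN : z \in `]- N, N[%classic.
  by rewrite inE/= in_itv/= -ltr_norml ltrDl.
have bound l y : `]- N, N[%classic l -> `]0, b]%classic y ->
    `|expR (y * l - y ^+ 2 * t / 2)| <= expR (b * N).
  rewrite /= !in_itv/= => /andP[_ lN] /andP[y0 yb].
  rewrite ger0_norm ?expR_ge0// ler_expR.
  have N0 : 0 < N by rewrite ltr_wpDl.
  have : y * l <= y * N by rewrite ler_pM2l// ltW.
  have : y * N <= b * N by rewrite ler_pM2r.
  have : 0 <= y ^+ 2 * t by rewrite mulr_ge0// sqr_ge0.
  lra.
apply: (@continuity_under_integral _ _ _ mu
  (fun l y => expR (y * l - y ^+ 2 * t / 2)) _ _ (- N) N _ _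
  (fun=> expR (b * N)) _ _ z zN).
- exact: measurable_itv.
- move=> l lN; apply: (@bounded_integrable _ _ _ _ (expR (b * N))).
  + exact: measurable_itv.
  + exact: measurable_exp.
  + by move=> y yb; apply: bound.
- apply: aeW => y _ l _; apply: continuous_comp; last exact: continuous_expR.
  apply: cvgB; last exact: cvg_cst.
  by apply: cvgM; [exact: cvg_cst|exact: cvg_id].
- apply: (@bounded_integrable _ _ _ _ (expR (b * N))).
  + exact: measurable_itv.
  + exact: measurable_cst.
  + by move=> y _; rewrite ger0_norm ?expR_ge0.
- by move=> l lN; apply: aeW => y; exact: bound.
Qed.

(** For [z >= 0] the integrand on [[d, b]] is at least [expR (d * z - b ^+ 2 * t / 2)], which is
    unbounded in [z]. *)
Lemma hfun_ge (x t : R) : 0 <= t -> 0 < x -> exists z, x <= hfun mu z t.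
Proof.
move=> t0 x0.
have mub : (0 < mu `]0%R, b]%classic)%E.
  have := mu_gt0; rewrite -(setUv `]0, b]%classic) measureU0//.
  - by apply: measurableC; exact: measurable_itv.
  - exact: supp_right_null.
have [d d0 mud] := measure_itvoc_gt0 _ _ _ mub.
set m := fine (mu `[d, b]%classic).
have m0 : 0 < m.
  by rewrite fine_gt0// mud ltey_eq fin_num_measure//; exact: measurable_itv.
(* The second entry solves [expR (d * z - b ^+ 2 * t / 2) * m = x]; the maximum with 0 makes [y * z]
   nondecreasing in [y]. *)
pose z := Num.max 0 ((ln (x / m) + b ^+ 2 * t / 2) / d).
have z0 : 0 <= z by rewrite le_max lexx.
have zd : ln (x / m) + b ^+ 2 * t / 2 <= d * z.
  by rewrite [d * z]mulrC -ler_pdivrMr// /z le_max lexx orbT.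
exists z; rewrite (@hfun_supp `]0, b]%classic); [|exact: measurable_itv|exact: supp_right_null].
apply: (@le_trans _ _ (expR (d * z - b ^+ 2 * t / 2) * m)).
  rewrite -ler_pdivrMr// -[leLHS]lnK ?posrE ?divr_gt0// ler_expR; lra.
apply: (@Rintegral_ge_cst _ _ _ _ _ (expR (b * z))).
- exact: measurable_itv.
- exact: measurable_itv.
- by move=> y /=; rewrite !in_itv/= => /andP[/(lt_le_trans d0) -> ->].
- exact: measurable_exp.
- move=> y /=; rewrite !in_itv/= => /andP[y0 yb]; rewrite expR_ge0 ler_expR.
  have : y * z <= b * z by rewrite ler_wpM2r.
  have : 0 <= y ^+ 2 * t by rewrite mulr_ge0// sqr_ge0.
  lra.
- move=> y /=; rewrite !in_itv/= => /andP[dy yb]; rewrite ler_expR.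
  have : d * z <= y * z by rewrite ler_wpM2r.
  have : y ^+ 2 * t <= b ^+ 2 * t.
    by rewrite ler_wpM2r// ler_sqr ?nnegrE//; lra.
  lra.
Qed.

(** For [z <= 0] the integrand is at most 1 on []0, d]], whose mass is below [x / 2], and at most
    [expR (d * z)] beyond [d]. Each piece contributes at most [x / 2]. *)
Lemma hfun_le (x t : R) : 0 <= t -> 0 < x -> exists z, hfun mu z t <= x.
Proof.
move=> t0 x0.
have [|d d0 mud] := measure_itvoc_small mu 0 (x / 2); first by rewrite divr_gt0.
have m0 (A : set R) : 0 <= fine (mu A) by rewrite fine_ge0.
set M := fine (mu `]d, +oo[%classic).
have M1 : 0 < M + 1 by rewrite ltr_wpDl// m0.
(* This makes [expR (d * z) * (M + 1) <= x / 2]; [M + 1] replaces [M], which may vanish. *)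
pose z := Num.min 0 (ln (x / (2 * (M + 1))) / d).
have z0 : z <= 0 by rewrite ge_min lexx.
have zd : d * z <= ln (x / (2 * (M + 1))).
  by rewrite [d * z]mulrC -ler_pdivlMr// /z ge_min lexx orbT.
have U : `]0, d]%classic `|` `]d, +oo[%classic = `]0, +oo[%classic :> set R.
  apply/seteqP; split => y /=; rewrite !in_itv/= !andbT.
    by case=> [/andP[]//|]; exact: lt_trans.
  by move=> y0; case: (leP y d) => yd; [left; rewrite y0|right].
have bound l y : 0 < y -> l <= y -> 0 <= expR (y * z - y ^+ 2 * t / 2) <= expR (l * z).
  move=> y0 ly; rewrite expR_ge0 ler_expR.
  have : y * z <= l * z by rewrite ler_wnM2r.
  have : 0 <= y ^+ 2 * t by rewrite mulr_ge0// sqr_ge0.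
  lra.
exists z; rewrite (@hfun_supp `]0, +oo[%classic); last 2 first.
- exact: measurable_itv.
- by rewrite setCitvr set_itvNyc.
rewrite -U Rintegral_setU; last 4 first.
- exact: measurable_itv.
- exact: measurable_itv.
- rewrite U; apply: (@bounded_integrable _ _ _ _ (expR (0 * z))).
  + exact: measurable_itv.
  + exact: measurable_exp.
  + move=> y /=; rewrite in_itv/= andbT => y0; rewrite ger0_norm ?expR_ge0//.
    by case/andP: (bound 0 y y0 (ltW y0)).
- apply/disj_setPS => y [/=]; rewrite !in_itv/= andbT => /andP[_].
  by rewrite leNgt => /negP.
rewrite (splitr x); apply: lerD.
  apply: le_trans (@Rintegral_le_cst _ _ _ _ 1 _ _ _) _.
  - exact: measurable_itv.
  - exact: measurable_exp.
  - move=> y /=; rewrite in_itv/= => /andP[y0 _].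
    by have := bound 0 y y0 (ltW y0); rewrite mul0r expR0.
  - rewrite mul1r -lee_fin fineK ?ltW// fin_num_measure//; exact: measurable_itv.
apply: le_trans (@Rintegral_le_cst _ _ _ _ (expR (d * z)) _ _ _) _.
- exact: measurable_itv.
- exact: measurable_exp.
- move=> y /=; rewrite in_itv/= andbT => dy.
  exact: bound (lt_trans d0 dy) (ltW dy).
rewrite -/M; apply: (@le_trans _ _ (x / (2 * (M + 1)) * M)).
  rewrite ler_wpM2r ?m0// -[leRHS]lnK ?ler_expR// posrE divr_gt0// mulr_gt0//.
rewrite invfM mulrA -mulrA -[leRHS]mulr1 ler_wpM2l//; first by rewrite divr_ge0// ltW.
by rewrite mulrC ler_pdivrMr// mul1r lerDl.
Qed.

(** [hinv] picks some preimage, and its default value 0 is ruled out once one exists. The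
    intermediate value theorem gives one; the order of [z1] and [z2] is not known, hence the two
    cases. *)
Lemma hinvK (x t : R) : 0 <= t -> 0 < x -> hfun mu (hinv mu x t) t = x.
Proof.
move=> t0 x0; rewrite /hinv.
suff [z zx] : exists z, hfun mu z t = x.
  exact: (@xgetPex _ 0 [set z' | hfun mu z' t = x] (ex_intro _ z zx)).
have [z1 z1x] := hfun_le _ _ t0 x0; have [z2 z2x] := hfun_ge _ _ t0 x0.
have [z12|/ltW z21] := leP z1 z2.
- have [||c _ cx] := @IVT _ (hfun mu ^~ t) z1 z2 x z12.
  + exact/continuous_subspaceT/hfun_continuous.
  + apply/andP; split; rewrite ?ge_min ?le_max; apply/orP; [left|right].
    exact: z1x. exact: z2x.
  + by exists c.
- have [||c _ cx] := @IVT _ (hfun mu ^~ t) z2 z1 x z21.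
  + exact/continuous_subspaceT/hfun_continuous.
  + apply/andP; split; rewrite ?ge_min ?le_max; apply/orP; [right|left].
    exact: z1x. exact: z2x.
  + by exists c.
Qed.

(** * Estimates for a fixed wealth [x0], and their limits as [t] grows *)

Section fixed_wealth.
Variable x0 : R.
Hypothesis x0_gt0 : 0 < x0.
Let D (t : R) := Delta mu x0 t.
Let M := fine (mu [set: R]).
Let E (t y : R) := expR (t * y * (2 * D t + a - y) / 2).

Let M_ge0 : 0 <= M.
Proof. by rewrite /M fine_ge0. Qed.

Let mE (t : R) : measurable_fun [set: R] (E t).
Proof.
apply: measurableT_comp => //; apply: measurable_funM => //.
by apply: measurable_funM; [exact: measurable_funM|exact: measurable_funB].
Qed.

Let mBE (t : R) : measurable_fun [set: R] (fun y => (y - a) * E t y).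
Proof. by apply: measurable_funM; [exact: measurable_funB|exact: mE]. Qed.

Let mBexp (t : R) :
  measurable_fun [set: R] (fun y => (y - a) * expR (- (t * y * (y - a) / 2))).
Proof.
apply: measurable_funM; first exact: measurable_funB.
apply: measurableT_comp => //; apply: measurableT_comp => //.
apply: measurable_funM => //.
by apply: measurable_funM; [exact: measurable_funM|exact: measurable_funB].
Qed.

(** Completing the square: [y * (c - y) <= c ^+ 2 / 4] with [c = 2 * D t + a]. A bound uniform in
    [y] gives integrability for the finite measure. *)
Let E_bound (t y : R) : 0 < t -> 0 <= E t y <= expR (t * (2 * D t + a) ^+ 2 / 8).
Proof.
move=> t0; rewrite expR_ge0 ler_expR.
have : 0 <= t * (2 * D t + a - 2 * y) ^+ 2 by rewrite mulr_ge0 ?sqr_ge0// ltW.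
lra.
Qed.

Let iE (t : R) : 0 < t -> mu.-integrable `[a, b]%classic (EFin \o E t).
Proof.
move=> t0; apply: (@bounded_integrable _ _ _ _ (expR (t * (2 * D t + a) ^+ 2 / 8))).
- exact: measurable_itv.
- exact: mE.
- by move=> y _; have /andP[E0 EK] := E_bound t y t0; rewrite ger0_norm.
Qed.

Let iBE (t : R) : 0 < t ->
  mu.-integrable `[a, b]%classic (EFin \o (fun y => (y - a) * E t y)).
Proof.
move=> t0; apply: (@bounded_integrable _ _ _ _ ((b - a) * expR (t * (2 * D t + a) ^+ 2 / 8))).
- exact: measurable_itv.
- exact: mBE.
- move=> y /=; rewrite in_itv/= => /andP[ay yb].
  have /andP[E0 EK] := E_bound t y t0.
  rewrite ger0_norm ?mulr_ge0 ?subr_ge0// ler_pM ?subr_ge0//.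
  by rewrite lerD2r.
Qed.

Let exponentE (t y : R) : 0 < t ->
  y * hinv mu x0 t - y ^+ 2 * t / 2 = t * y * (2 * D t + a - y) / 2.
Proof. by move=> t0; rewrite /D /Delta -/a; field; rewrite gt_eqF. Qed.

Lemma Rintegral_exp_Delta (t : R) : 0 < t -> \int[mu]_y E t y = x0.
Proof.
move=> t0; apply: etrans (hinvK _ _ (ltW t0) x0_gt0).
by apply: eq_Rintegral => y _; rewrite exponentE.
Qed.

Lemma rtol_subE (t : R) : 0 < t ->
  rtol mu x0 t - a * x0 = \int[mu]_(y in `[a, b]%classic) ((y - a) * E t y).
Proof.
move=> t0; have mab : measurable (`[a, b]%classic : set R) by exact: measurable_itv.
have -> : rtol mu x0 t = \int[mu]_(y in `[a, b]%classic) (y * E t y).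
  rewrite -(Rintegral_conull _ _ _ mab supp_null).
    by apply: eq_Rintegral => y _; rewrite exponentE.
  by apply: measurable_funM => //; exact: mE.
rewrite -[in a * x0](Rintegral_exp_Delta _ t0) (Rintegral_conull _ _ _ mab supp_null)//.
rewrite -RintegralZl//; last exact: iE.
apply/eqP; rewrite subr_eq -RintegralD//.
- by apply/eqP; apply: eq_Rintegral => y _ /=; ring.
- exact: iBE.
- exact: (integrableZl mab a (iE _ t0)).
Qed.

Lemma rtol_sub_ge0 (t : R) : 0 < t -> 0 <= rtol mu x0 t - a * x0.
Proof.
move=> t0; rewrite rtol_subE//; apply: Rintegral_ge0 => y /=.
by rewrite in_itv/= => /andP[ay _]; rewrite mulr_ge0 ?subr_ge0// expR_ge0.
Qed.

(** [Gfun] sends [D t = 0] to this branch; both formulas agree there. *)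
Lemma Gfun_le0E (gamma t : R) : b = (1 - gamma)^-1 -> D t <= 0 ->
  Gfun mu gamma x0 t =
  \int[mu]_(y in `[a, b]%classic) ((y - a) * expR (- (t * y * (y - a) / 2))).
Proof. by move=> bg D0; rewrite /Gfun -/(D t) D0 -bg set_itvcc. Qed.

Lemma Gfun_gt0E (gamma t : R) : b = (1 - gamma)^-1 -> 0 < D t ->
  Gfun mu gamma x0 t = 2 * D t * x0 +
  \int[mu]_(y in `[a + 2 * D t, b]%classic) ((y - a) * E t y).
Proof. by move=> bg D0; rewrite /Gfun -/(D t) leNgt D0/= -bg set_itvcc. Qed.

(* With w = y - a - s, the weight is at most (w + s) exp (- t w ^ 2 / 2),
   because y >= w >= 0. *)
Lemma exp_weight_le (t s y : R) : 0 < t -> 0 <= s -> a + s <= y ->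
  0 <= (y - a) * expR (t * y * (s + a - y) / 2) <= (Num.sqrt (2 * t))^-1 + s.
Proof.
move=> t0 s0 sy; have a0 := supp_left_ge0.
have y0 : 0 <= y - a - s by lra.
rewrite mulr_ge0 ?expR_ge0//; last by lra.
have q0 : 0 < Num.sqrt (2 * t) by rewrite sqrtr_gt0 mulr_gt0.
have -> : (y - a) * expR (t * y * (s + a - y) / 2) =
  (y - a - s) * expR (t * y * (s + a - y) / 2) + s * expR (t * y * (s + a - y) / 2).
  by ring.
apply: lerD.
  apply: le_trans (mul_expRN_sqr_le _ _ (y - a - s) q0).
  rewrite ler_wpM2l// ler_expR sqr_sqrtr; last by rewrite mulr_ge0// ltW.
  have : 0 <= t * (y - a - s) * (a + s).
    by rewrite mulr_ge0 ?addr_ge0// mulr_ge0// ltW.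
  lra.
rewrite -[leRHS]mulr1 ler_wpM2l// -[leRHS]expR0 ler_expR.
have : 0 <= t * y * (y - a - s) by rewrite mulr_ge0// mulr_ge0; lra.
lra.
Qed.

Lemma rtol_sub_le_Gfun (gamma t : R) : b = (1 - gamma)^-1 -> 0 < t ->
  rtol mu x0 t - a * x0 <= Gfun mu gamma x0 t.
Proof.
move=> bg t0; rewrite rtol_subE//.
have mab : measurable (`[a, b]%classic : set R) by exact: measurable_itv.
have [D0|D0] := leP (D t) 0.
(* Dropping [2 * D t <= 0] from the exponent only enlarges it, as [t * y >= 0] on the support. *)
- rewrite (Gfun_le0E _ _ bg D0); apply: le_Rintegral => //; first exact: iBE.
    apply: (@bounded_integrable _ _ _ _ ((Num.sqrt (2 * t))^-1 + 0)) => //.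
    move=> y /=; rewrite in_itv/= => /andP[ay _].
    have := @exp_weight_le t 0 y t0 (lexx _); rewrite addr0 => /(_ ay).
    have -> : t * y * (0 + a - y) / 2 = - (t * y * (y - a) / 2) by ring.
    by move=> /andP[w0 w1]; rewrite ger0_norm.
  move=> y /=; rewrite in_itv/= => /andP[ay _].
  rewrite ler_wpM2l ?subr_ge0// ler_expR.
  have : 0 <= t * y * - D t.
    by rewrite !mulr_ge0 ?oppr_ge0 ?(ltW t0)// (le_trans supp_left_ge0).
  lra.
- rewrite (Gfun_gt0E _ _ bg D0).
  pose J : set R := `[a + 2 * D t, b]%classic.
  have mJ : measurable J by exact: measurable_itv.
  have JE : `[a, b]%classic `&` J = J.
    apply/setIidPr; rewrite /J => y /=; rewrite !in_itv/= => /andP[ay ->]; rewrite andbT.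
    by apply: le_trans ay; rewrite lerDl mulr_ge0// ltW.
  have iJ : mu.-integrable `[a, b]%classic (EFin \o ((fun y => (y - a) * E t y) \_ J)).
    rewrite -restrict_EFin; apply/(integrable_restrict mu mJ mab).
    by rewrite JE; apply: integrableS (iBE _ t0) => //; rewrite -JE; exact: subIsetl.
  (* With [x0] written as the integral of [E t], [G] becomes the integral over [[a, b]] of
     [2 * D t * E t y] plus the part of [(y - a) * E t y] on [J], so the comparison is pointwise. *)
  rewrite -/J -JE Rintegral_mkcondr -(Rintegral_exp_Delta _ t0).
  rewrite (Rintegral_conull _ _ _ mab supp_null)// -RintegralZl//; last exact: iE.
  have iZ := integrableZl mab (2 * D t) (iE _ t0).
  rewrite -RintegralD//; apply: le_Rintegral => //; first exact: iBE.
    exact: (integrableD mab iZ iJ).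
  move=> y /=; rewrite in_itv/= => /andP[ay yb].
  rewrite patchE; case: ifPn => [_|].
    by rewrite lerDr mulr_ge0 ?expR_ge0// mulr_ge0// ltW.
  rewrite notin_setE /J /= in_itv/= yb andbT => /negP; rewrite -ltNge => yD.
  by rewrite addr0 ler_wpM2r ?expR_ge0//; lra.
Qed.

(** The weight bound, with shift [s = 0] or [s = 2 * D t], is integrated against a mass of at most
    [M]. The maximum merges both signs of [D t], so an upper bound on [D t] suffices for
    [G -> 0]. *)
Lemma Gfun_le (gamma t : R) : b = (1 - gamma)^-1 -> 0 < t ->
  Gfun mu gamma x0 t <=
  M * (Num.sqrt (2 * t))^-1 + 2 * Num.max 0 (D t) * (x0 + M).
Proof.
move=> bg t0.
have q0 : 0 <= (Num.sqrt (2 * t))^-1 by rewrite invr_ge0 sqrtr_ge0.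
have MA (A : set R) : measurable A -> fine (mu A) <= M.
  move=> mA; apply: fine_le; rewrite ?fin_num_measure//.
  by apply: le_measure; rewrite ?inE.
have [D0|D0] := leP (D t) 0.
- rewrite mulr0 mul0r addr0 (Gfun_le0E _ _ bg D0).
  apply: le_trans (@Rintegral_le_cst _ _ _ _ (Num.sqrt (2 * t))^-1 _ _ _) _.
  + exact: measurable_itv.
  + exact: (mBexp t).
  + move=> y /=; rewrite in_itv/= => /andP[ay _].
    have := @exp_weight_le t 0 y t0 (lexx _); rewrite !addr0 => /(_ ay).
    by have -> : t * y * (0 + a - y) / 2 = - (t * y * (y - a) / 2) by ring.
  + by rewrite mulrC ler_wpM2r//; apply: MA; exact: measurable_itv.
- rewrite (Gfun_gt0E _ _ bg D0).
  have D2 : 0 <= 2 * D t by rewrite mulr_ge0// ltW.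
  have : \int[mu]_(y in `[a + 2 * D t, b]%classic) ((y - a) * E t y) <=
      ((Num.sqrt (2 * t))^-1 + 2 * D t) * M.
    apply: le_trans (@Rintegral_le_cst _ _ _ _ ((Num.sqrt (2 * t))^-1 + 2 * D t) _ _ _) _.
    + exact: measurable_itv.
    + exact: mBE.
    + by move=> y /=; rewrite in_itv/= => /andP[ay _]; exact: exp_weight_le.
    + by rewrite ler_wpM2l ?addr_ge0//; apply: MA; exact: measurable_itv.
  lra.
Qed.

(* If [D t > e], the integrand of [h] is at least [exp (t d e / 2)] on a set
   [d, a + e] of positive mass, with [d > 0], so that [h] outgrows [x0]. *)
Lemma Delta_near_le (e : R) : 0 < e -> \forall t \near +oo, D t <= e.
Proof.
move=> e0.
have [|d d0 mud] := @measure_itvoc_gt0 _ mu 0 (a + e).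
  by apply: supp_left_itvoc_gt0; rewrite ltrDl.
set m := fine (mu `[d, a + e]%classic).
have m0 : 0 < m.
  by rewrite fine_gt0// mud ltey_eq fin_num_measure//; exact: measurable_itv.
near=> t.
have t0 : 0 < t by near: t; exact: nbhs_pinfty_gt.
rewrite leNgt; apply/negP => eD.
have : expR (t * d * e / 2) * m <= x0.
  rewrite -(Rintegral_exp_Delta _ t0).
  apply: (@Rintegral_ge_cst _ _ _ _ _ (expR (t * (2 * D t + a) ^+ 2 / 8))).
  - exact: measurable_itv.
  - exact: measurableT.
  - exact: subsetT.
  - exact: mE.
  - by move=> y _; exact: E_bound.
  - move=> y /=; rewrite in_itv/= => /andP[dy yae]; rewrite ler_expR.
    (* From [e < D t] and [y <= a + e] the factor [2 * D t + a - y] exceeds [e], while [y >= d]. *)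
    rewrite ler_pM2r// ler_pM ?mulr_ge0 ?ler_pM2l//; lra.
apply/negP; rewrite -ltNge -ltr_pdivrMr//.
(* Bounding the exponential below by [1 + u] leaves a linear condition, with explicit threshold
   [(x0 / m - 1) / (d * e / 2)] for [t]. *)
apply: lt_le_trans (expR_ge1Dx _); rewrite -ltrBlDl.
have -> : t * d * e / 2 = t * (d * e / 2) by ring.
rewrite -ltr_pdivrMr; last by rewrite divr_gt0// mulr_gt0.
by near: t; apply: nbhs_pinfty_gt; exact: num_real.
Unshelve. all: by end_near. Qed.

Lemma Gfun_cvg0 (gamma : R) : b = (1 - gamma)^-1 -> Gfun mu gamma x0 @ +oo --> 0.
Proof.
move=> bg; apply/cvgr0Pnorm_le => e e0.
have xM : 0 < x0 + M by rewrite ltr_pwDl.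
near=> t.
have t0 : 0 < t by near: t; exact: nbhs_pinfty_gt.
have G0 := le_trans (rtol_sub_ge0 _ t0) (rtol_sub_le_Gfun _ _ bg t0).
rewrite ger0_norm//; apply: le_trans (Gfun_le _ _ bg t0) _.
(* Chosen so that [2 * Num.max 0 (D t) * (x0 + M) <= e / 2]. *)
have Dmax : Num.max 0 (D t) <= e / (4 * (x0 + M)).
  rewrite ge_max divr_ge0/= ?(ltW e0)//; last by rewrite mulr_ge0// ltW.
  by near: t; apply: Delta_near_le; rewrite divr_gt0// mulr_gt0.
(* Once [Num.sqrt (2 * t)] passes this threshold, the other term is at most
   [e / 2 * M / (M + 1)]. *)
have k0 : 0 < 2 * (M + 1) / e by rewrite divr_gt0// mulr_gt0// ltr_wpDl.
have qk : 2 * (M + 1) / e <= Num.sqrt (2 * t).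
  rewrite -[leLHS](ger0_norm (ltW k0)) -sqrtr_sqr ler_wsqrtr//.
  rewrite [2 * t]mulrC -ler_pdivrMr; last by [].
  by near: t; apply: nbhs_pinfty_ge; exact: num_real.
rewrite (splitr e) lerD//.
- have M1 : M * (Num.sqrt (2 * t))^-1 <= M * (2 * (M + 1) / e)^-1.
    by rewrite ler_wpM2l// lef_pV2// posrE// (lt_le_trans k0).
  apply: le_trans M1 _; rewrite invf_div mulrA ler_pdivrMr ?mulr_gt0 ?ltr_wpDl//.
  lra.
- rewrite -ler_pdivlMr// -ler_pdivlMl//; apply: le_trans Dmax _.
  by rewrite invfM; lra.
Unshelve. all: by end_near. Qed.

(** Dividing the sandwich by [x0] squeezes the ratio between [a] and [a + G / x0]. *)
Lemma rtol_div_cvg (gamma : R) : b = (1 - gamma)^-1 ->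
  (fun t => rtol mu x0 t / x0) @ +oo --> a.
Proof.
move=> bg.
apply: (@squeeze_cvgr _ _ _ _ (fun=> a) (fun t => a + Gfun mu gamma x0 t / x0)).
- near=> t; have t0 : 0 < t by near: t; exact: nbhs_pinfty_gt.
  have := rtol_sub_ge0 _ t0; have := rtol_sub_le_Gfun _ _ bg t0.
  rewrite ler_pdivlMr// ler_pdivrMr// mulrDl divfK ?gt_eqF// subr_ge0 => ? ->/=.
  by rewrite -lerBlDl.
- exact: cvg_cst.
- rewrite -[X in _ --> X]addr0 -(mul0r x0^-1); apply: cvgD; first exact: cvg_cst.
  by apply: cvgM; [exact: Gfun_cvg0|exact: cvg_cst].
Unshelve. all: by end_near. Qed.

End fixed_wealth.

End support.

Theorem theorem9 (R : realType) (mu : {finite_measure set R -> \bar R})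
  (gamma : R) :
  (* mu is a measure on (0, oo) *)
  mu [set y : R | y <= 0] = 0%E ->
  (* mu is nonzero *)
  (0 < mu [set: R])%E ->
  (* exponential moments: int y e^{yz} mu(dy) < oo for every z *)
  (forall z : R, mu.-integrable [set: R] (fun y => (y * expR (y * z))%:E)) ->
  gamma < 1 ->
  supp_right mu = (1 - gamma)^-1 ->
  forall x0 : R, 0 < x0 ->
    [/\ (fun t => rtol mu x0 t / x0) @ +oo --> supp_left mu,
        Gfun mu gamma x0 @ +oo --> 0
      & \forall t \near +oo,
          0 <= rtol mu x0 t - supp_left mu * x0 <= Gfun mu gamma x0 t].
Proof.
move=> mu_le0 mu_gt0 _ gamma1 bg x0 x0_gt0.
(* Positivity separates a genuine right end point from the value 0 that [inf] takes on the empty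
   set. *)
have b0 : 0 < supp_right mu by rewrite bg invr_gt0 subr_gt0.
split.
- exact: (rtol_div_cvg _ mu_le0 mu_gt0 b0 _ x0_gt0 _ bg).
- exact: (Gfun_cvg0 _ mu_le0 mu_gt0 b0 _ x0_gt0 _ bg).
- near=> t; have t0 : 0 < t by near: t; exact: nbhs_pinfty_gt.
  by rewrite rtol_sub_ge0//= rtol_sub_le_Gfun.
Unshelve. all: by end_near. Qed.
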